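(* Let $(M_{k,l})_{k,l\ge 1}$ be the sequence defined by $M_{k,1} = M_{1,l} = 1$ for all $k,l \geq 1$, and, for $k,l\ge 2$, \[M_{k,l} = \left(M_{k,l-1}^{-1/\mu} + M_{k-1,l}^{-1/\mu}\right)^{-\mu}, \quad \text{where } \mu = \max(k, l).\] Then $c_t \geq M_{t,t}$ for every $t\ge 1$.
   Context: For a graph $G$, $k_t(G)$ denotes the number of complete subgraphs on $t$ vertices in $G$, and $\overline{G}$ is the complement of $G$. Let $k_t(n) = \min\{k_t(G) + k_t(\overline{G}) : |G| = n\}$, i.e. the minimum number of monochromatic copies of $K_t$ in a two-colouring of the edges of $K_n$. The Ramsey multiplicity constant is $c_t = \lim_{n\to\infty} k_t(n)/\binom{n}{t}$ (this limit exists since the ratios $k_t(n)/\binom{n}{t}$ are nondecreasing in $n$ and bounded by $1$). *)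

(* Defs.v *)
From HB Require Import structures.
From mathcomp Require Import all_boot all_order all_algebra.
From mathcomp Require Import all_classical all_reals all_analysis.

Set Implicit Arguments.
Unset Strict Implicit.
Unset Printing Implicit Defensive.

Import Order.TTheory GRing.Theory Num.Theory.
Import numFieldNormedType.Exports.

(* A simple graph on T is given by its set of edges, an edge being an         *)
(* unordered pair of distinct vertices.                                       *)
Record sgraph (T : finType) := SGraph {
  edges : {set {set T}};
  _ : edges \subset [set e : {set T} | #|e| == 2]
}.

HB.instance Definition _ (T : finType) := [isSub for @edges T].
HB.instance Definition _ (T : finType) := [Finite of sgraph T by <:].

Section Graphs.
Variable T : finType.

Definition empty_sgraph : sgraph T :=
  @SGraph T finset.set0 (finset.sub0set _).

Definition compl_sgraph (G : sgraph T) : sgraph T :=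
  @SGraph T ([set e : {set T} | #|e| == 2] :\: edges G) (finset.subsetDl _ _).

Definition adj (G : sgraph T) (x y : T) : bool := [set x; y]%SET \in edges G.

Definition clique (G : sgraph T) (A : {set T}) : bool :=
  [forall x in A, forall y in A, (x != y) ==> adj G x y].

Definition num_cliques (t : nat) (G : sgraph T) : nat :=
  #|[set A : {set T} | (#|A| == t) && clique G A]|.

Definition num_mono (t : nat) (G : sgraph T) : nat :=
  num_cliques t G + num_cliques t (compl_sgraph G).

End Graphs.

Definition min_mono (t n : nat) : nat :=
  num_mono t [arg min_(G < empty_sgraph 'I_n) num_mono t G].

Local Open Scope ring_scope.
Local Open Scope classical_set_scope.

(* For n < t the ratio is the conventional value _ / 0 = 0, which does not    *)
(* affect the limit.                                                          *)
Definition ramsey_mult (R : realType) (t : nat) : R :=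
  lim (((min_mono t n)%:R / 'C(n, t)%:R : R) @[n --> \oo]).

(* The values at k = 0 or l = 0 are junk.                                     *)
Fixpoint Mseq (R : realType) (k : nat) {struct k} : nat -> R :=
  fix Mk (l : nat) {struct l} : R :=
    match k, l with
    | k'.+1, l'.+1 =>
        if (k == 1%N) || (l == 1%N) then 1 else
        let mu : R := (maxn k l)%:R in
        (Mk l' `^ (- 1 / mu) + Mseq R k' l `^ (- 1 / mu)) `^ (- mu)
    | _, _ => 1
    end.

Lemma MseqS1 (R : realType) (k : nat) : (1 <= k)%N -> Mseq R k 1 = 1.
Proof. by case: k => [|[|k]]. Qed.

Lemma Mseq1S (R : realType) (l : nat) : (1 <= l)%N -> Mseq R 1 l = 1.
Proof. by case: l. Qed.

Lemma MseqE (R : realType) (k l : nat) : (2 <= k)%N -> (2 <= l)%N ->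
  let mu : R := (maxn k l)%:R in
  Mseq R k l =
    (Mseq R k l.-1 `^ (- 1 / mu) + Mseq R k.-1 l `^ (- 1 / mu)) `^ (- mu).
Proof. by case: k => [|[|k]] //; case: l => [|[|l]]. Qed.

(* Main.v *)
Require Import Defs.
From mathcomp Require Import all_boot all_order all_algebra.
From mathcomp Require Import all_classical all_reals all_analysis.
From mathcomp Require Import lra fintype finset.

(* Colour the edges of K_n red (G) and blue (its complement), and count tuples
   in which any two entries are equal or joined in the given colour. Allowing
   repetitions makes the red and the blue neighbourhood of a vertex both
   contain that vertex, so the Erdos-Szekeres recursion holds for every vertex
   set A with no error term: A contains at least M_{k,l} |A|^k red k-tuples or
   at least M_{k,l} |A|^l blue l-tuples. Indeed put
   p = (M_{k,l} / M_{k-1,l})^(1/mu) and q = (M_{k,l} / M_{k,l-1})^(1/mu); the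
   recursion says exactly p + q = 1. Hence each vertex has red degree at
   least p |A| or blue degree at least q |A|, and either a proportion p of the
   vertices is of the first kind or a proportion q is of the second kind.
   Repetitions contribute O(n^(k-1)) tuples, so the ratio min_mono t n / C(n, t)
   is at least M_{t,t} - O(1/n); it converges because it is bounded and
   nondecreasing in n (delete a vertex and average). *)

Set Implicit Arguments.
Unset Strict Implicit.
Unset Printing Implicit Defensive.

Import Order.TTheory GRing.Theory Num.Theory.
Import numFieldNormedType.Exports.

Local Open Scope ring_scope.

Lemma exchange_sum_card (I J : finType) (A : {set I}) (B : {set J})
    (P : I -> J -> bool) :
  (\sum_(i in A) #|[set j in B | P i j]| =
   \sum_(j in B) #|[set i in A | P i j]|)%N.
Proof.
under eq_bigr do rewrite -sum1dep_card.
rewrite (exchange_big_dep (mem B)) /= => [|i j _ /andP[] //].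
by apply: eq_bigr => j jB; rewrite -sum1dep_card; under eq_bigl do rewrite jB.
Qed.

Lemma leq_ffact_expn n k : (n ^_ k <= n ^ k)%N.
Proof.
rewrite ffact_prod -[k in leqRHS]card_ord -prod_nat_const.
by apply: leq_prod => i _; apply: leq_subr.
Qed.

Section Tuples.
Variables (T : finType) (e : rel T).

Definition nbhd (v : T) : {set T} := [set u | e v u].

Definition closed_nbhd (v : T) : {set T} := v |: nbhd v.

(* Counts the tuples of k elements of A, repetitions allowed, in which any two
   entries are equal or adjacent. *)
Fixpoint num_tuples (k : nat) (A : {set T}) : nat :=
  if k is k'.+1 then (\sum_(v in A) num_tuples k' (A :&: closed_nbhd v))%N
  else 1%N.

Lemma num_tuples1 (A : {set T}) : num_tuples 1 A = #|A|.
Proof. exact: sum1_card. Qed.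

Lemma num_tuplesS k (A : {set T}) :
  num_tuples k.+1 A = (\sum_(v in A) num_tuples k (A :&: closed_nbhd v))%N.
Proof. by []. Qed.

Lemma num_tuples_subset k (A B : {set T}) :
  A \subset B -> (num_tuples k A <= num_tuples k B)%N.
Proof.
elim: k A B => [//|k IHk] A B sAB; rewrite !num_tuplesS.
rewrite [leqRHS](big_setID A) /= (setIidPr sAB) -[leqLHS]addn0 leq_add //.
by apply: leq_sum => v _; apply/IHk/setSI.
Qed.

Lemma num_tuples_le_expn k (A : {set T}) : (num_tuples k A <= #|T| ^ k)%N.
Proof.
elim: k A => [//|k IHk] A; rewrite num_tuplesS expnS.
apply: leq_trans (leq_mul (max_card A) (leqnn _)).
by rewrite -sum_nat_const; apply: leq_sum.
Qed.

Lemma num_tuples_setU1 k v (A : {set T}) :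
  (num_tuples k (v |: A) <= num_tuples k A + k * #|T| ^ k.-1)%N.
Proof.
elim: k A => [//|k IHk] A; have [vA|vA] := boolP (v \in A).
  by rewrite (setUidPr _) ?sub1set // leq_addr.
rewrite !num_tuplesS big_setU1 //= mulSn addnCA.
apply: leq_add; first exact: num_tuples_le_expn.
apply: (@leq_trans (\sum_(u in A)
    (num_tuples k (A :&: closed_nbhd u) + k * #|T| ^ k.-1))).
  apply: leq_sum => u _; apply: leq_trans (IHk _); apply: num_tuples_subset.
  by rewrite setIUl setSU ?subsetIl.
rewrite big_split leq_add2l sum_nat_const mulnCA leq_mul2l.
by case: k {IHk} => // k; rewrite expnS leq_mul2r max_card orbT.
Qed.

Lemma num_tuplesS_ge (R : numDomainType) (c : R) k (A D : {set T}) :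
    D \subset A ->
    {in D, forall v, c <= (num_tuples k (A :&: closed_nbhd v))%:R} ->
  c * #|D|%:R <= (num_tuples k.+1 A)%:R.
Proof.
move=> sDA c_le; rewrite mulr_natr -sumr_const num_tuplesS natr_sum.
rewrite [leRHS](big_setID D) /= (setIidPr sDA).
by apply: ler_wpDr; [apply: sumr_ge0 | apply: ler_sum].
Qed.

End Tuples.

Section Cliques.
Variables (T : finType) (G : sgraph T).

Lemma adj_sym : symmetric (adj G).
Proof. by move=> x y; rewrite /adj setUC. Qed.

Lemma adj_irrefl : irreflexive (adj G).
Proof.
move=> x; apply/negP; rewrite /adj setUid => xG.
by have /subsetP/(_ _ xG) := valP G; rewrite inE cards1.
Qed.

Lemma adj_compl x y : x != y -> adj (compl_sgraph G) x y = ~~ adj G x y.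
Proof. by move=> xy; rewrite /adj !inE cards2 xy andbT. Qed.

Lemma cliqueP (A : {set T}) :
  reflect {in A &, forall x y, x != y -> adj G x y} (clique G A).
Proof.
apply: (iffP forall_inP) => [cA x y xA yA xy|cA x xA].
  by have /forall_inP/(_ _ yA)/implyP := cA x xA; apply.
by apply/forall_inP => y yA; apply/implyP; apply: cA.
Qed.

Lemma clique_setU1 v (S : {set T}) : v \notin S ->
  clique G (v |: S) = (S \subset nbhd (adj G) v) && clique G S.
Proof.
move=> vS; have neq_v x : x \in S -> v != x by apply: contraTneq => <-.
apply/cliqueP/andP => [cvS|[/subsetP sSv /cliqueP cS] x y].
  split; last by apply/cliqueP => x y xS yS; apply: cvS; apply: setU1r.
  by apply/subsetP => x xS; rewrite inE cvS ?setU11 ?setU1r ?neq_v.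
case/setU1P => [->|xS] /setU1P[->|yS] xy; first by rewrite eqxx in xy.
- by have := sSv _ yS; rewrite inE.
- by have := sSv _ xS; rewrite inE adj_sym.
- exact: cS.
Qed.

Definition cliques_in (k : nat) (A : {set T}) : {set {set T}} :=
  [set S : {set T} | [&& S \subset A, #|S| == k & clique G S]].

Lemma card_cliques_inT k : #|cliques_in k [set: T]| = num_cliques k G.
Proof. by apply: eq_card => S; rewrite !inE subsetT. Qed.

Lemma card_cliques_in_le k (A : {set T}) : (#|cliques_in k A| <= 'C(#|A|, k))%N.
Proof.
rewrite -cards_draws; apply/subset_leq_card/subsetP => S.
by rewrite !inE => /and3P[-> ->].
Qed.

Lemma cliques_in_setU1 k v (A S : {set T}) : v \in A -> v \notin S ->
  (v |: S \in cliques_in k.+1 A) = (S \in cliques_in k (A :&: nbhd (adj G) v)).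
Proof.
move=> vA vS; rewrite !inE subUset sub1set vA cardsU1 vS clique_setU1 //.
by rewrite subsetI add1n eqSS (andbCA (#|S| == k)) -!andbA.
Qed.

Lemma card_cliques_through k v (A : {set T}) : v \in A ->
  #|[set S in cliques_in k.+1 A | v \in S]| =
  #|cliques_in k (A :&: nbhd (adj G) v)|.
Proof.
pose link := cliques_in k (A :&: nbhd (adj G) v).
move=> vA; have v_notin S : S \in link -> v \notin S.
  rewrite inE => /and3P[/subsetP sS _ _]; apply/negP => /sS.
  by rewrite !inE adj_irrefl andbF.
have setU1_inj : {in link &, injective (fun S => v |: S)}.
  by move=> S1 S2 /v_notin v1 /v_notin v2 eqS; rewrite -(setU1K v1) eqS setU1K.
rewrite -(card_in_imset setU1_inj); apply: eq_card => S; rewrite inE.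
apply/andP/imsetP => [[cS vS]|[S' linkS' ->]].
  by exists (S :\ v); rewrite -?cliques_in_setU1 ?setD1K // setD11.
by rewrite cliques_in_setU1 ?v_notin // setU11.
Qed.

Lemma sum_card_cliques_nbhd k (A : {set T}) :
  (\sum_(v in A) #|cliques_in k (A :&: nbhd (adj G) v)| =
   k.+1 * #|cliques_in k.+1 A|)%N.
Proof.
under eq_bigr => v vA do rewrite -card_cliques_through //.
rewrite exchange_sum_card mulnC -sum_nat_const; apply: eq_bigr => S.
rewrite inE => /and3P[/setIidPr sSA /eqP <- _].
by apply: eq_card => v; rewrite -{2}sSA !inE.
Qed.

Lemma sum_card_cliques_setC1 k :
  (\sum_v #|cliques_in k [set~ v]| = (#|T| - k) * num_cliques k G)%N.
Proof.
have avoiding v : #|cliques_in k [set~ v]| =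
    #|[set S in cliques_in k setT | v \notin S]|.
  by apply: eq_card => S; rewrite !inE subsetT subsetC sub1set inE andbC.
under eq_bigr do rewrite avoiding.
rewrite -(eq_bigl _ _ (@in_setT T)) exchange_sum_card.
rewrite -card_cliques_inT mulnC -sum_nat_const.
apply: eq_bigr => S; rewrite inE => /and3P[_ /eqP <- _].
rewrite -(cardsC S) addKn.
by apply: eq_card => v; rewrite !inE.
Qed.

(* 'C(k, 2) * #|T| ^ k.-1 bounds the number of tuples with a repeated entry. *)
Lemma num_tuples_le_cliques k (A : {set T}) :
  (num_tuples (adj G) k A <=
     k`! * #|cliques_in k A| + 'C(k, 2) * #|T| ^ k.-1)%N.
Proof.
elim: k A => [|k IHk] A.
  rewrite mul1n addn0 card_gt0; apply/set0Pn; exists set0.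
  by rewrite inE sub0set cards0 eqxx; apply/cliqueP => x y; rewrite inE.
pose err := ('C(k.+1, 2) * #|T| ^ k.-1)%N.
apply: (@leq_trans (\sum_(v in A)
    (k`! * #|cliques_in k (A :&: nbhd (adj G) v)| + err))).
  apply: leq_sum => v vA.
  rewrite /closed_nbhd setIUr (setIidPr _) ?sub1set //.
  apply: leq_trans (num_tuples_setU1 _ _ _ _) _.
  by rewrite /err binS bin1 mulnDl addnA leq_add2r.
rewrite big_split -big_distrr sum_nat_const /= sum_card_cliques_nbhd.
rewrite factS mulnA [(k`! * _)%N]mulnC leq_add2l /err mulnCA leq_mul2l.
by case: k {IHk err} => // k; rewrite expnS leq_mul2r max_card !orbT.
Qed.

End Cliques.

Section PreimageGraph.
Variables (T U : finType) (f : U -> T).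
Hypothesis f_inj : injective f.

Lemma preim_sgraph_subproof (G : sgraph T) :
  [set e : {set U} | f @: e \in edges G] \subset [set e : {set U} | #|e| == 2].
Proof.
apply/subsetP => e; rewrite !inE => eG.
by have /subsetP/(_ _ eG) := valP G; rewrite inE card_imset.
Qed.

Definition preim_sgraph (G : sgraph T) : sgraph U :=
  SGraph (preim_sgraph_subproof G).

Lemma adj_preim G x y : adj (preim_sgraph G) x y = adj G (f x) (f y).
Proof. by rewrite /adj inE imsetU !imset_set1. Qed.

Lemma preim_sgraph_compl G :
  preim_sgraph (compl_sgraph G) = compl_sgraph (preim_sgraph G).
Proof. by apply/val_inj/setP => e; rewrite !inE card_imset. Qed.

Lemma clique_preim G (S : {set U}) :
  clique (preim_sgraph G) S = clique G (f @: S).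
Proof.
apply/cliqueP/cliqueP => cS.
  move=> _ _ /imsetP[x xS ->] /imsetP[y yS ->].
  by rewrite inj_eq // -adj_preim; apply: cS.
move=> x y xS yS; rewrite adj_preim -(inj_eq f_inj).
by apply: cS; apply: imset_f.
Qed.

Lemma num_cliques_preim k G :
  num_cliques k (preim_sgraph G) = #|cliques_in G k (f @: [set: U])|.
Proof.
rewrite -card_cliques_inT -(card_imset _ (imset_inj f_inj)).
apply: eq_card => S; apply/imsetP/idP => [[S'] + ->|].
  by rewrite !inE clique_preim card_imset // imsetS ?subsetT // => /andP[].
rewrite !inE => /and3P[/subsetP sS cardS cS].
have defS : f @: (f @^-1: S) = S.
  apply/setP => x; apply/imsetP/idP => [[y + ->]|xS]; first by rewrite inE.
  by have /imsetP[y _ def_x] := sS _ xS; exists y; rewrite // inE -def_x.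
exists (f @^-1: S); last by rewrite defS.
by rewrite !inE subsetT clique_preim -(card_imset _ f_inj) defS cardS.
Qed.

End PreimageGraph.

Lemma num_mono_le (T : finType) t (G : sgraph T) :
  (num_mono t G <= 2 * 'C(#|T|, t))%N.
Proof.
rewrite mul2n -addnn -cardsT.
by rewrite leq_add // -card_cliques_inT card_cliques_in_le.
Qed.

Lemma min_mono_attained t n :
  exists G : sgraph 'I_n, min_mono t n = num_mono t G.
Proof. by eexists. Qed.

Lemma min_mono_le t n (G : sgraph 'I_n) : (min_mono t n <= num_mono t G)%N.
Proof. by rewrite /min_mono; case: arg_minnP => // H _; apply. Qed.

Lemma min_mono_le_cliques_in (T : finType) t (G : sgraph T) (A : {set T}) :
  (min_mono t #|A| <=
     #|cliques_in G t A| + #|cliques_in (compl_sgraph G) t A|)%N.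
Proof.
have codom_enum_val : enum_val @: [set: 'I_#|A|] = A.
  apply/setP => x; apply/imsetP/idP => [[i _ ->]|xA]; first exact: enum_valP.
  by exists (enum_rank_in xA x); rewrite ?enum_rankK_in.
have card_in H :
    #|cliques_in H t A| = num_cliques t (preim_sgraph (@enum_val_inj _ A) H).
  by rewrite num_cliques_preim codom_enum_val.
by rewrite !card_in preim_sgraph_compl min_mono_le.
Qed.

Lemma min_monoS t n :
  (n.+1 * min_mono t n <= (n.+1 - t) * min_mono t n.+1)%N.
Proof.
have [G ->] := min_mono_attained t n.+1.
have sum_deletions (H : sgraph 'I_n.+1) :
    ((n.+1 - t) * num_cliques t H = \sum_v #|cliques_in H t [set~ v]|)%N.
  by rewrite sum_card_cliques_setC1 card_ord.
rewrite /num_mono mulnDr !sum_deletions -big_split -{1}(card_ord n.+1).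
rewrite -sum_nat_const; apply: leq_sum => v _.
by have := min_mono_le_cliques_in t G [set~ v]; rewrite cardsC1 card_ord.
Qed.

Section RamseyDensity.
Variables (R : realFieldType) (T : finType).

Definition edge_cover (r b : rel T) := forall x y, x != y -> r x y || b x y.

Definition high_degree (e : rel T) (p : R) (A : {set T}) : {set T} :=
  [set v in A | p * #|A|%:R <= #|A :&: closed_nbhd e v|%:R].

Lemma high_degree_dichotomy r b (p q : R) (A : {set T}) :
    edge_cover r b -> p + q <= 1 ->
  p * #|A|%:R <= #|high_degree r p A|%:R \/
  q * #|A|%:R <= #|high_degree b q A|%:R.
Proof.
move=> rb pq1; have split_A : p * #|A|%:R + q * #|A|%:R <= #|A|%:R.
  by rewrite -mulrDl ler_piMl.
have degree_sum v :
    (#|A| <= #|A :&: closed_nbhd r v| + #|A :&: closed_nbhd b v|)%N.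
  apply: leq_trans (leq_card_setU _ _); apply/subset_leq_card/subsetP => u uA.
  by rewrite !inE uA /=; case: eqVneq => //= uv; apply: rb; rewrite eq_sym.
have : A \subset high_degree r p A :|: high_degree b q A.
  apply/subsetP => v vA; rewrite !inE vA /= -implyNb -ltNge.
  apply/implyP => low_red.
  by have := degree_sum v; rewrite -(ler_nat R) natrD; lra.
move=> /subset_leq_card/leq_trans/(_ (leq_card_setU _ _)).
rewrite -(ler_nat R) natrD => card_A.
have [|few] := lerP (p * #|A|%:R) #|high_degree r p A|%:R; first by left.
by right; lra.
Qed.

Definition ramsey_density (r b : rel T) (k l : nat) (M : R) :=
  forall A : {set T}, M * #|A|%:R ^+ k <= (num_tuples r k A)%:R \/
                      M * #|A|%:R ^+ l <= (num_tuples b l A)%:R.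

Lemma ramsey_densityC r b k l M :
  ramsey_density r b k l M -> ramsey_density b r l k M.
Proof. by move=> rbM A; case: (rbM A); [right | left]. Qed.

(* Each v of high degree either lies in at least M (p |A|)^k red tuples or
   already provides p^mu M |A|^l blue ones.  As k < mu, the former exceeds
   p^mu M |A|^k by a factor 1/p, which pays for the vertices of high degree
   being only a proportion p of A. *)
Lemma num_tuples_high_degree r b k l mu (p M : R) (A : {set T}) :
    0 <= p <= 1 -> 0 <= M -> (k < mu)%N -> (l <= mu)%N ->
    ramsey_density r b k l M -> p * #|A|%:R <= #|high_degree r p A|%:R ->
  p ^+ mu * M * #|A|%:R ^+ k.+1 <= (num_tuples r k.+1 A)%:R \/
  p ^+ mu * M * #|A|%:R ^+ l <= (num_tuples b l A)%:R.
Proof.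
move=> /andP[p0 p1] M0 kmu lmu rbM many.
have pA0 : 0 <= p * #|A|%:R by rewrite mulr_ge0.
have absorb m : (m <= mu)%N ->
    p ^+ mu * M * #|A|%:R ^+ m <= M * (p * #|A|%:R) ^+ m.
  move=> mmu; rewrite exprMn mulrA [M * _]mulrC.
  by rewrite ler_wpM2r ?exprn_ge0 // ler_wpM2r // ler_wiXn2l.
have [|few_b] := lerP (p ^+ mu * M * #|A|%:R ^+ l) (num_tuples b l A)%:R.
  by right.
left; apply: le_trans (absorb _ kmu) _.
have monotone v m : v \in high_degree r p A ->
    M * (p * #|A|%:R) ^+ m <= M * #|A :&: closed_nbhd r v|%:R ^+ m.
  by rewrite inE => /andP[_ deg]; rewrite ler_wpM2l // lerXn2r ?nnegrE.
have many_through v : v \in high_degree r p A ->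
    M * (p * #|A|%:R) ^+ k <= (num_tuples r k (A :&: closed_nbhd r v))%:R.
  move=> vD; have [|many_b] := rbM (A :&: closed_nbhd r v).
    exact: le_trans (monotone v k vD).
  move: few_b; rewrite ltNge => /negP[]; apply: le_trans (absorb _ lmu) _.
  apply: le_trans (monotone v l vD) _; apply: le_trans many_b _.
  by rewrite ler_nat num_tuples_subset ?subsetIl.
apply: le_trans (num_tuplesS_ge _ many_through); last first.
  by apply/subsetP => v; rewrite inE => /andP[].
by rewrite exprSr mulrA ler_wpM2l // mulr_ge0 ?exprn_ge0.
Qed.

Lemma ramsey_densitySS r b k l (p q Mr Mb M : R) :
    edge_cover r b ->
    0 <= p -> 0 <= q -> p + q <= 1 -> 0 <= Mr -> 0 <= Mb ->
    p ^+ maxn k.+1 l.+1 * Mr = M -> q ^+ maxn k.+1 l.+1 * Mb = M ->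
    ramsey_density r b k l.+1 Mr -> ramsey_density r b k.+1 l Mb ->
  ramsey_density r b k.+1 l.+1 M.
Proof.
move=> rb p0 q0 pq1 Mr0 Mb0 defMr defMb rbMr rbMb A.
have p1 : p <= 1 by lra.
have q1 : q <= 1 by lra.
have [many|many] := high_degree_dichotomy A rb pq1.
  rewrite -defMr; apply: num_tuples_high_degree => //.
  - by rewrite p0.
  - exact: leq_maxl.
  - exact: leq_maxr.
apply/or_comm; rewrite -defMb.
apply: num_tuples_high_degree (ramsey_densityC rbMb) many => //.
- by rewrite q0.
- exact: leq_maxr.
- exact: leq_maxl.
Qed.

End RamseyDensity.

Section Recursion.
Variable R : realType.

Lemma powR_invXn (x : R) n : 0 < x -> (0 < n)%N ->
  x `^ (- 1 / n%:R) ^+ n = x^-1.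
Proof.
move=> x0 n0; rewrite -powR_mulrn ?powR_ge0 // -powRrM divfK.
  by rewrite powR_inv1 ?ltW.
by rewrite pnatr_eq0 -lt0n.
Qed.

Lemma powR_harmonic_split (x y : R) n : 0 < x -> 0 < y -> (0 < n)%N ->
  let z := (x `^ (- 1 / n%:R) + y `^ (- 1 / n%:R)) `^ (- n%:R) in
  exists p q : R,
    [/\ 0 <= p, 0 <= q, p + q = 1, p ^+ n * x = z & q ^+ n * y = z].
Proof.
move=> x0 y0 n0 z; rewrite {}/z.
have := powR_invXn x0 n0; have := powR_invXn y0 n0.
have := powR_gt0 (- 1 / n%:R) x0; have := powR_gt0 (- 1 / n%:R) y0.
set a := x `^ _; set b := y `^ _ => b0 a0 bn an.
have ab0 : 0 < a + b by rewrite addr_gt0.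
exists (a / (a + b)), (b / (a + b)).
rewrite !divr_ge0 ?ltW // powR_invn ?ltW // !expr_div_n an bn; split=> //.
- by rewrite -mulrDl divff ?gt_eqF.
- by rewrite mulrAC mulVf ?mul1r ?gt_eqF.
- by rewrite mulrAC mulVf ?mul1r ?gt_eqF.
Qed.

Lemma Mseq_gt0 k l : 0 < Mseq R k l.
Proof.
elim: k l => [|k IHk]; first by case.
elim=> [//|l IHl] /=; case: ifP => // _.
by apply: powR_gt0; apply: addr_gt0; apply: powR_gt0.
Qed.

Lemma ramsey_density_Mseq (T : finType) (r b : rel T) k l :
  edge_cover r b -> ramsey_density r b k l (Mseq R k l).
Proof.
move=> rb; elim: k l => [|k IHk] l; first by case: l => *; left; rewrite mul1r.
elim: l => [|l IHl]; first by right; rewrite mul1r.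
case: k => [|k] in IHk IHl *.
  by move=> A; left; rewrite Mseq1S // num_tuples1 expr1 mul1r.
case: l => [|l] in IHl *.
  by move=> A; right; rewrite MseqS1 // num_tuples1 expr1 mul1r.
rewrite MseqE // addrC.
have [|||p [q [p0 q0 pq defMr defMb]]] :=
  @powR_harmonic_split (Mseq R k.+1 l.+2) (Mseq R k.+2 l.+1) (maxn k.+2 l.+2).
- exact: Mseq_gt0.
- exact: Mseq_gt0.
- by rewrite leq_max.
apply: (ramsey_densitySS rb p0 q0 _ _ _ defMr defMb) => //.
- by rewrite pq.
- exact/ltW/Mseq_gt0.
- exact/ltW/Mseq_gt0.
Qed.

End Recursion.

Lemma num_mono_ge (R : realType) (T : finType) t (G : sgraph T) :
  Mseq R t t * #|T|%:R ^+ t <=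
    (t`! * num_mono t G + 'C(t, 2) * #|T| ^ t.-1)%:R.
Proof.
have cover : edge_cover (adj G) (adj (compl_sgraph G)).
  by move=> x y xy; rewrite adj_compl // orbN.
rewrite -[#|T| in leLHS]cardsT.
have [many|many] := @ramsey_density_Mseq R T _ _ t t cover setT.
all: apply: le_trans many _; rewrite ler_nat.
all: apply: leq_trans (num_tuples_le_cliques _ _ _) _.
all: by rewrite card_cliques_inT leq_add2r leq_mul2l ?leq_addr ?leq_addl orbT.
Qed.

Section Limit.
Variables (R : realType) (t : nat).

Definition min_mono_ratio (n : nat) : R := (min_mono t n)%:R / 'C(n, t)%:R.

Lemma min_mono_ratio_nondecreasing : nondecreasing_seq min_mono_ratio.
Proof.
apply/nondecreasing_seqP => n; rewrite /min_mono_ratio.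
have [nt|tn] := ltnP n t; first by rewrite (bin_small nt) invr0 mulr0 divr_ge0.
rewrite ler_pdivrMr ?ltr0n ?bin_gt0 // mulrAC.
rewrite ler_pdivlMr ?ltr0n ?bin_gt0 ?leqW //.
rewrite -!natrM ler_nat -(leq_pmul2l (_ : 0 < n.+1 - t)%N) ?subn_gt0 ?ltnS //.
rewrite mulnCA -mul_bin_down mulnCA !mulnA leq_mul2r.
by rewrite min_monoS orbT.
Qed.

Lemma min_mono_ratio_ubound : has_ubound (range min_mono_ratio).
Proof.
exists 2 => _ [n _ <-]; rewrite /min_mono_ratio.
have [nt|tn] := ltnP n t; first by rewrite (bin_small nt) invr0 mulr0.
have [G ->] := min_mono_attained t n.
rewrite ler_pdivrMr ?ltr0n ?bin_gt0 // -natrM ler_nat.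
by have := num_mono_le t G; rewrite card_ord.
Qed.

Lemma min_mono_ratio_ge n : (0 < n)%N -> (t <= n)%N ->
  Mseq R t t - 'C(t, 2)%:R / n%:R <= min_mono_ratio n.
Proof.
move=> n0 tn; set bound := _ - _.
have [neg|/ltW pos] := lerP bound 0; first by rewrite (le_trans neg) ?divr_ge0.
rewrite ler_pdivlMr ?ltr0n ?bin_gt0 //.
rewrite -(ler_pM2l (_ : 0 < t`!%:R)) ?ltr0n ?fact_gt0 // mulrCA -!natrM.
rewrite [(t`! * 'C(_, _))%N]mulnC bin_ffact.
apply: (@le_trans _ _ (bound * n%:R ^+ t)).
  by rewrite ler_wpM2l // -natrX ler_nat leq_ffact_expn.
rewrite mulrBl lerBlDr.
have -> : 'C(t, 2)%:R / n%:R * n%:R ^+ t = ('C(t, 2) * n ^ t.-1)%:R :> R.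
  case: (t) => [|t']; first by rewrite !mul0r.
  by rewrite exprS mulrA divfK ?pnatr_eq0 -?lt0n // natrM natrX.
have [G ->] := min_mono_attained t n.
by have := num_mono_ge R t G; rewrite card_ord natrD.
Qed.

End Limit.

Lemma cvg_subr_divn (R : realType) (x c : R) :
  ((x - c / n%:R) @[n --> \oo] --> x)%classic.
Proof.
rewrite -[X in (_ --> X)%classic]subr0 -(mulr0 c).
apply: cvgB; first exact: cvg_cst.
apply: cvgMl_tmp; apply/gtr0_cvgV0; last exact: cvgr_idn.
by near=> n; rewrite ltr0n; near: n; exact: nbhs_infty_gt.
Unshelve. all: by end_near. Qed.

Theorem theorem4 (R : realType) (t : nat) (ht : (1 <= t)%N) :
  Mseq R t t <= ramsey_mult R t.
Proof.
have ratio_cvg : cvgn (min_mono_ratio R t).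
  exact: nondecreasing_is_cvgn (min_mono_ratio_nondecreasing R t)
                               (min_mono_ratio_ubound R t).
rewrite -[ramsey_mult R t]/(limn (min_mono_ratio R t)).
apply: ler_cvg_to (cvg_subr_divn 'C(t, 2)%:R) ratio_cvg _.
near=> n; have tn : (t <= n)%N by near: n; exact: nbhs_infty_ge.
exact: min_mono_ratio_ge (leq_trans ht tn) tn.
Unshelve. all: by end_near. Qed.
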